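(* Let $p$ be an odd prime and let $G$ be a connected bipartite graph. Then the tensor product graph $K_p\times G$ is a Legendre cordial graph modulo $p$.
   Context: All graphs are finite, simple, and connected. $K_p$ is the complete graph on $p$ vertices. A graph $G$ is bipartite if $V(G)$ can be partitioned into two non-empty subsets $V_1,V_2$ such that every edge of $G$ has one end in $V_1$ and one end in $V_2$. Tensor product: $G_1\times G_2$ has vertex set $V(G_1)\times V(G_2)$ and edge set $\{(v_1,u_1)(v_2,u_2): v_1v_2\in E(G_1)\text{ and }u_1u_2\in E(G_2)\}$. Legendre symbol: for an odd prime $p$ and an integer $a$ relatively prime to $p$, $(a/p)=1$ if $x^2\equiv a\pmod p$ has a solution and $(a/p)=-1$ otherwise. Legendre cordial labeling: let $p$ be an odd prime and $H$ a simple connected graph of order (number of vertices) $N$. A bijection $f:V(H)\to\{1,2,\ldots,N\}$ is a Legendre cordial labeling modulo $p$ if the induced function $f_p^*:E(H)\to\{0,1\}$, defined by $f_p^*(uv)=0$ if $([f(u)+f(v)]/p)=-1$ or $f(u)+f(v)\equiv 0\pmod p$, and $f_p^*(uv)=1$ if $([f(u)+f(v)]/p)=1$, satisfies $|e_{f_p^*}(0)-e_{f_p^*}(1)|\leq 1$, where $e_{f_p^*}(i)$ is the number of edges with label $i$ ($i=0,1$). A graph admitting such a labeling is called a Legendre cordial graph modulo $p$. *)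

(* Defs.v *)
From HB Require Import structures.
From mathcomp Require Import all_boot all_order all_algebra.

Set Implicit Arguments.
Unset Strict Implicit.
Unset Printing Implicit Defensive.

Import Order.TTheory GRing.Theory Num.Theory.

Record sgraph := SGraph {
  vertex :> finType;
  adj : rel vertex;
  adj_sym : symmetric adj;
  adj_irr : irreflexive adj
}.

(* The empty graph is not connected. *)
Definition connected (G : sgraph) : Prop :=
  0 < #|G| /\ forall x y : G, connect (@adj G) x y.

Definition bipartite (G : sgraph) : Prop :=
  exists V1 V2 : {set G},
    [/\ V1 != set0, V2 != set0, V1 :|: V2 = [set: G], [disjoint V1 & V2] &
        forall x y : G, adj x y ->
          (x \in V1) && (y \in V2) || (y \in V1) && (x \in V2)].

Section Complete.
Variable n : nat.

Definition complete_adj : rel 'I_n := fun i j => i != j.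

Lemma complete_adj_sym : symmetric complete_adj.
Proof. by move=> i j; rewrite /complete_adj eq_sym. Qed.

Lemma complete_adj_irr : irreflexive complete_adj.
Proof. by move=> i; rewrite /complete_adj eqxx. Qed.

Definition complete : sgraph := SGraph complete_adj_sym complete_adj_irr.
End Complete.

Notation "''K_' n" := (complete n)
  (at level 0, n at level 2, format "''K_' n") : type_scope.

Section Tensor.
Variables G1 G2 : sgraph.

Definition tensor_adj : rel (G1 * G2)%type :=
  fun a b => adj a.1 b.1 && adj a.2 b.2.

Lemma tensor_adj_sym : symmetric tensor_adj.
Proof. by move=> a b; rewrite /tensor_adj adj_sym [adj a.2 _]adj_sym. Qed.

Lemma tensor_adj_irr : irreflexive tensor_adj.
Proof. by move=> a; rewrite /tensor_adj adj_irr. Qed.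

Definition tensor : sgraph := SGraph tensor_adj_sym tensor_adj_irr.
End Tensor.

(* Restricting x to the residues 0, ..., p - 1 loses no solution of
   x ^ 2 = a mod p, see quad_residueP. *)
Definition quad_residue (p : nat) (a : int) : bool :=
  [exists x : 'I_p, (x%:Z ^+ 2 == a %[mod p])%Z].

Lemma quad_residueP (p : nat) (a : int) : 0 < p ->
  reflect (exists x : int, (x ^+ 2 = a %[mod p])%Z) (quad_residue p a).
Proof.
move=> p_gt0; apply: (iffP existsP) => [[x /eqP xa]|[x xa]].
  by exists (Posz x).
have pZ0 : Posz p != 0%R by rewrite eqz_nat -lt0n.
have xm_ge0 := modz_ge0 x pZ0.
have xm_lt : (`|(x %% p)%Z| < p)%N.
  by rewrite -ltz_nat gez0_abs // ltz_mod.
by exists (Ordinal xm_lt); rewrite /= gez0_abs // modzXm xa.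
Qed.

(* Only the values at a relatively prime to p matter; the value 0 at the
   multiples of p is the usual convention. *)
Definition legendre (p : nat) (a : int) : int :=
  if (p %| a)%Z then 0%R else if quad_residue p a then 1%R else (-1)%R.

Section Labeling.
Variables (p : nat) (H : sgraph) (f : H -> nat).

Definition legendre_label (u v : H) : nat :=
  if (legendre p (f u + f v)%N == (-1)%R) || (p %| f u + f v) then 0 else 1.

Lemma legendre_labelC u v : legendre_label u v = legendre_label v u.
Proof. by rewrite /legendre_label addnC. Qed.

(* Edges are unordered pairs of vertices; by legendre_labelC the label does not
   depend on the orientation. *)
Definition edges_labeled (i : nat) : {set {set H}} :=
  [set [set uv.1; uv.2] | uv : H * H
     & adj uv.1 uv.2 && (legendre_label uv.1 uv.2 == i)].

Definition legendre_cordial_labeling : Prop :=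
  [/\ injective f,
      (forall k : nat, (exists v : H, f v = k) <-> 1 <= k <= #|H|) &
      (`|#|edges_labeled 0|%:Z - #|edges_labeled 1|%:Z| <= 1)%R].
End Labeling.

(* Legendre cordiality is a notion about connected graphs. *)
Definition legendre_cordial (p : nat) (H : sgraph) : Prop :=
  connected H /\ exists f : H -> nat, legendre_cordial_labeling p f.

(* Main.v *)
Require Import Defs.
From HB Require Import structures.
From mathcomp Require Import all_boot all_order all_algebra.
From mathcomp Require Import all_fingroup all_solvable all_field.

(** The labeling puts a full residue system mod p on each fibre K_p x {x}, so
    that the label of (i, x) is congruent to i when x lies in one part V of the
    bipartition and to - i when it lies in the other ([fibre_label],
    [natr_fibre_label]).  An edge of the tensor product joins (i, x) to (j, y)
    with i <> j and x, y in different parts, hence its labels sum to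
    +/- (i - j), which is never 0 mod p ([natr_fibre_label_edge]): only the
    quadratic character of the sum matters.

    The two edge classes have the same size because an automorphism of the graph
    exchanges them.  In a finite field of odd order there is a nonzero c whose
    multiplication exchanges nonzero squares and nonsquares
    ([finField_nonsquare_mul]); multiplying the K_p coordinate by c
    ([scale_fibre]) preserves adjacency and multiplies the sum along every edge
    by c, so it flips every edge label ([card_edges_labeled_swap]).

    The product is connected because K_p has a triangle and every vertex of G
    has a neighbour ([complete_tensor_connected]). *)

Set Implicit Arguments.
Unset Strict Implicit.
Unset Printing Implicit Defensive.

Import GRing.Theory Num.Theory.

(** * Squares in finite fields *)

Definition is_square (F : finFieldType) (a : F) : bool :=
  [exists x : F, (x ^+ 2 == a)%R].

(** The unit group is cyclic of even order, so whether a power g ^ k of a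
    generator g is a square depends only on the parity of k, and c = g changes
    that parity. *)
Lemma finField_nonsquare_mul (F : finFieldType) : odd #|F| ->
  exists2 c : F, c != 0%R &
    forall a : F, a != 0%R -> is_square (c * a)%R = ~~ is_square a.
Proof.
move=> F_odd.
have /cyclicP[g gE] := field_unit_group_cyclic [set: {unit F}]%G.
have g_even : ~~ odd #[g]%g.
  rewrite /order -gE card_finField_unit.
  by move: F_odd; case: #|F| => //= n; rewrite negbK.
have squareE k : is_square (val g ^+ k)%R = ~~ odd k.
  apply/existsP/idP => [[x /eqP xx]|k_even]; last first.
    exists (val g ^+ k./2)%R.
    by rewrite -exprM muln2 -{2}[k]odd_double_half (negbTE k_even).
  have x_unit : x \is a GRing.unit.
    by rewrite -(unitrX_pos x (ltn0Sn 1)) xx unitrX // (valP g).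
  have : FinRing.unit F x_unit \in <[g]>%g by rewrite -gE inE.
  case/cycleP => m /(congr1 val) /=; rewrite FinRing.val_unitX => xm.
  (* k = 2 m modulo the order of g, which is even, so k is even. *)
  have /eqP : (g ^+ k)%g = (g ^+ (m * 2))%g.
    by apply: val_inj; rewrite !FinRing.val_unitX exprM -xm xx.
  rewrite eq_expg_mod_order => /eqP km.
  have g2 : 2 %| #[g]%g by rewrite dvdn2.
  by rewrite -dvdn2 /dvdn -(modn_dvdm k g2) km modn_dvdm // modnMl.
exists (val g) => [|a a_neq0]; first by rewrite -unitfE (valP g).
have a_unit : a \is a GRing.unit by rewrite unitfE.
have : FinRing.unit F a_unit \in <[g]>%g by rewrite -gE inE.
case/cycleP => k /(congr1 val) /=; rewrite FinRing.val_unitX => ->.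
by rewrite -exprS !squareE.
Qed.

(** * Edge labels as squares in the prime field *)

Lemma eqr_nat_Fp p m n : prime p ->
  (m%:R == n%:R :> 'F_p)%R = (m == n %[mod p]).
Proof. by move=> p_prime; rewrite -val_eqE /= !val_Fp_nat. Qed.

Lemma natr_Fp_eq0 p n : prime p -> (n%:R == 0 :> 'F_p)%R = (p %| n).
Proof. by move=> p_prime; rewrite (eqr_nat_Fp n 0 p_prime) mod0n. Qed.

Lemma quad_residue_Fp (p n : nat) : prime p ->
  quad_residue p n = is_square (n%:R : 'F_p)%R.
Proof.
move=> p_prime; have p_gt0 := prime_gt0 p_prime.
have modE m : (m%:Z ^+ 2 == n %[mod p])%Z = ((m%:R : 'F_p) ^+ 2 == n%:R)%R.
  by rewrite -natrX eqr_nat_Fp // -!(PoszM, rmorphXn) /= !modz_nat.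
apply/existsP/existsP => [[i]|[x]]; first by rewrite modE; exists (i%:R)%R.
have x_lt : x < p by rewrite -[X in _ < X](Fp_cast p_prime).
by rewrite -[x]natr_Zp => xx; exists (Ordinal x_lt); rewrite modE.
Qed.

(** Label 0 merges the nonresidues with the multiples of p, whence the
    conjunction on the right, read as a number. *)
Lemma legendre_labelE p (H : sgraph) (f : H -> nat) u v : prime p ->
  legendre_label p f u v =
    ((f u + f v)%:R != 0 :> 'F_p)%R && is_square ((f u + f v)%:R : 'F_p)%R.
Proof.
move=> p_prime; rewrite /legendre_label /legendre natr_Fp_eq0 //.
rewrite -quad_residue_Fp //.
have -> : (p %| Posz (f u + f v))%Z = (p %| f u + f v) by [].
by case: (_ %| _); case: quad_residue.
Qed.

(** * Edge classes under an automorphism *)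

Section LabelSwap.
Variables (p : nat) (H : sgraph) (f : H -> nat) (phi : H -> H).
Hypotheses (phi_inj : injective phi)
  (phi_adj : forall u v : H, adj u v -> adj (phi u) (phi v)).

Lemma leq_card_edges_labeled (i j : nat) :
  (forall u v : H, adj u v -> legendre_label p f u v = i ->
     legendre_label p f (phi u) (phi v) = j) ->
  #|edges_labeled p f i| <= #|edges_labeled p f j|.
Proof.
move=> phi_label; rewrite -(card_imset (edges_labeled p f i) (imset_inj phi_inj)).
apply/subset_leq_card/subsetP => _ /imsetP[e /imsetP[[u v] /= + ->] ->].
rewrite inE /= => /andP[uv /eqP luv].
apply/imsetP; exists (phi u, phi v); last by rewrite /= imsetU !imset_set1.
by rewrite inE /= phi_adj //= (phi_label _ _ uv luv).
Qed.

(** The image map of phi on edges is injective and sends each class into the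
    other, which bounds either cardinal by the other one. *)
Lemma card_edges_labeled_swap :
  (forall u v : H, adj u v ->
     legendre_label p f (phi u) (phi v) = 1 - legendre_label p f u v) ->
  #|edges_labeled p f 0| = #|edges_labeled p f 1|.
Proof.
move=> swap; apply/eqP; rewrite eqn_leq.
by rewrite !leq_card_edges_labeled // => u v uv luv; rewrite swap // luv.
Qed.
End LabelSwap.

(** * Connectedness of the product *)

(** A walk in G lifts with arbitrary K_n coordinates at both ends.  Over a single
    edge of G an unchanged coordinate i is reached by a walk of length 3 around a
    triangle of K_n, which is where 2 < n is needed; over a walk of length 0 a
    detour through a neighbour does it. *)
Lemma complete_tensor_connected n (G : sgraph) :
  2 < n -> connected G -> (exists x y : G, adj x y) -> connected (tensor 'K_n G).
Proof.
move=> n_gt2 [_ G_conn] [a [b ab]].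
have n_gt0 : 0 < n by apply: leq_trans n_gt2.
pose i0 : 'K_n := Ordinal n_gt0.
have edge (i j : 'K_n) (x y : G) : i != j -> adj x y ->
    connect (@adj (tensor 'K_n G)) (i, x) (j, y).
  by move=> ij xy; apply/connect1; rewrite /= /tensor_adj /= /complete_adj ij.
have avoid (i j : 'K_n) : exists k : 'K_n, (k != i) && (k != j).
  have /card_gt0P[k] : 0 < #|~: [set i; j]|.
    by rewrite cardsCs setCK subn_gt0 card_ord cards2; case: (i != j);
       rewrite // ltnW.
  by rewrite !inE negb_or; exists k.
have step (i j : 'K_n) (x y : G) : adj x y ->
    connect (@adj (tensor 'K_n G)) (i, x) (j, y).
  move=> xy; have [-> | /edge] := eqVneq i j; last exact.
  have [k /andP[kj _]] := avoid j j; have [l /andP[lj lk]] := avoid j k.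
  have yx : adj y x by rewrite adj_sym.
  apply: connect_trans (edge _ k _ _ _ xy) _; first by rewrite eq_sym.
  apply: connect_trans (edge k l _ _ _ yx) (edge l j _ _ lj xy).
  by rewrite eq_sym.
have neighbor (x : G) : exists y, adj x y.
  have [[|y q] /= xq xa] := connectP (G_conn x a); first by exists b; rewrite -xa.
  by case/andP: xq => xy _; exists y.
split; first by apply/card_gt0P; exists (i0, a).
move=> [i x] [j y]; have /connectP[q] := G_conn x y.
elim: q i x => [|z q IH] i x /=.
  move=> _ ->; have [z xz] := neighbor x.
  by apply: connect_trans (step i i0 _ _ xz) (step _ _ _ _ _); rewrite adj_sym.
by case/andP=> xz zq yE; apply: connect_trans (step i i0 _ _ xz) (IH _ _ zq yE).
Qed.

(** * The labeling by signed residues *)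

Section FibreLabeling.
Variables (p : nat) (G : sgraph) (V : {set G}).
Hypothesis p_prime : prime p.

(** The representative in 1, ..., p (rather than 0, ..., p - 1, as labels start
    at 1) of i if b holds, and of - i otherwise. *)
Definition fibre_offset (b : bool) (i : nat) : nat :=
  if b then (if i == 0 then p else i) else p - i.

Definition fibre_label (u : tensor 'K_p G) : nat :=
  p * enum_rank u.2 + fibre_offset (u.2 \in V) u.1.

Lemma fibre_offset_bounds b i : i < p -> 0 < fibre_offset b i <= p.
Proof.
move=> ip; have p_gt0 := prime_gt0 p_prime.
rewrite /fibre_offset; case: b; last by rewrite subn_gt0 ip leq_subr.
by have [_|/negbTE] := eqVneq i 0; rewrite ?p_gt0 ?leqnn // => i0; rewrite lt0n i0 ltnW.
Qed.

Lemma natr_fibre_offset b i : i < p ->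
  ((fibre_offset b i)%:R = (-1) ^+ (~~ b) * i%:R :> 'F_p)%R.
Proof.
move=> ip; have p0 : (p%:R = 0 :> 'F_p)%R by apply/eqP; rewrite natr_Fp_eq0.
rewrite /fibre_offset; case: b => /=; last first.
  by rewrite natrB ?(ltnW ip) // p0 sub0r expr1 mulN1r.
by have [->|_] := eqVneq i 0; rewrite mul1r ?p0.
Qed.

Lemma natr_fibre_label u :
  ((fibre_label u)%:R = (-1) ^+ (u.2 \notin V) * (u.1 : 'I_p)%:R :> 'F_p)%R.
Proof.
have p0 : (p%:R = 0 :> 'F_p)%R by apply/eqP; rewrite natr_Fp_eq0.
by rewrite natrD natrM p0 mul0r add0r natr_fibre_offset ?ltn_ord.
Qed.

(** The predecessor of a label is given in Euclidean form: its quotient by p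
    recovers the fibre. *)
Lemma fibre_label_pred u :
  (fibre_label u).-1 = enum_rank u.2 * p + (fibre_offset (u.2 \in V) u.1).-1
  /\ (fibre_offset (u.2 \in V) u.1).-1 < p.
Proof.
have /andP[off_gt0 off_le] := fibre_offset_bounds (u.2 \in V) (ltn_ord u.1).
rewrite /fibre_label mulnC; split; last by rewrite prednK.
by case: fibre_offset off_gt0 => // r _; rewrite addnS.
Qed.

Lemma fibre_label_bounds u : 1 <= fibre_label u <= #|tensor 'K_p G|.
Proof.
have /andP[off_gt0 off_le] := fibre_offset_bounds (u.2 \in V) (ltn_ord u.1).
rewrite addn_gt0 off_gt0 orbT /= card_prod card_ord.
apply: leq_trans (leq_add (leqnn _) off_le) _.
by rewrite -mulnSr leq_mul2l ltn_ord orbT.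
Qed.

(** The quotient of the label determines the fibre, hence the sign, and then the
    residue determines the K_p coordinate. *)
Lemma fibre_label_inj : injective fibre_label.
Proof.
have p_gt0 := prime_gt0 p_prime.
move=> u v uv.
have rank_uv : enum_rank u.2 = enum_rank v.2 :> nat.
  have [uE u_lt] := fibre_label_pred u; have [vE v_lt] := fibre_label_pred v.
  have := congr1 (fun n => n.-1 %/ p) uv.
  by rewrite uE vE !divnMDl // !divn_small // !addn0.
have /ord_inj/enum_rank_inj snd_uv := rank_uv.
have /eqP : ((fibre_label u)%:R = (fibre_label v)%:R :> 'F_p)%R by rewrite uv.
rewrite !natr_fibre_label snd_uv (inj_eq (mulfI _)) ?signr_eq0 //.
rewrite eqr_nat_Fp // !modn_small ?ltn_ord // => /eqP/ord_inj.
by case: u v {uv rank_uv} snd_uv => [i x] [j y] /= -> ->.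
Qed.

(** An injection between finite sets of the same cardinal is onto. *)
Lemma fibre_label_onto k :
  1 <= k <= #|tensor 'K_p G| -> exists u, fibre_label u = k.
Proof.
case/andP=> k_gt0 k_le.
have label_lt u : (fibre_label u).-1 < #|tensor 'K_p G|.
  by have /andP[] := fibre_label_bounds u; case: fibre_label.
have label_inj : injective (fun u => Ordinal (label_lt u)).
  move=> u v [] uv; apply: fibre_label_inj.
  have /andP[u_gt0 _] := fibre_label_bounds u.
  have /andP[v_gt0 _] := fibre_label_bounds v.
  by rewrite -(prednK u_gt0) uv prednK.
have [|g _ gK] := inj_card_bij label_inj; first by rewrite card_ord.
have k_lt : k.-1 < #|tensor 'K_p G| by rewrite prednK.
exists (g (Ordinal k_lt)); have /(congr1 val) /= := gK (Ordinal k_lt).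
have /andP[u_gt0 _] := fibre_label_bounds (g (Ordinal k_lt)).
by move=> eq_pred; rewrite -(prednK u_gt0) eq_pred prednK.
Qed.

(** Opposite signs at the two ends turn the sum of the labels into a difference,
    which cannot vanish on an edge. *)
Lemma natr_fibre_label_edge (u v : tensor 'K_p G) :
  (u.2 \in V) != (v.2 \in V) ->
  ((fibre_label u + fibre_label v)%:R =
     (-1) ^+ (u.2 \notin V) * ((u.1 : 'I_p)%:R - (v.1 : 'I_p)%:R) :> 'F_p)%R.
Proof.
rewrite natrD !natr_fibre_label mulrBr.
by case: (u.2 \in V); case: (v.2 \in V) => //= _;
   rewrite ?expr0 ?expr1 ?mulN1r ?mul1r ?opprK.
Qed.

(** * Scaling the fibres *)

Definition scale_fibre (c : 'F_p) (u : tensor 'K_p G) : tensor 'K_p G :=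
  (Ordinal (ltn_pmod (c * (u.1 : 'I_p)) (prime_gt0 p_prime)), u.2).

Lemma natr_scale_fibre c u :
  (((scale_fibre c u).1 : 'I_p)%:R = c * (u.1 : 'I_p)%:R :> 'F_p)%R.
Proof. by rewrite /= Fp_nat_mod // natrM natr_Zp. Qed.

Lemma scale_fibre_eq1 c u v : (c != 0)%R ->
  ((scale_fibre c u).1 == (scale_fibre c v).1) = (u.1 == v.1).
Proof.
have eq_Fp (i j : 'I_p) : (i == j) = (i%:R == j%:R :> 'F_p)%R.
  by rewrite eqr_nat_Fp // !modn_small.
by move=> c0; rewrite !eq_Fp !natr_scale_fibre (inj_eq (mulfI c0)).
Qed.

Lemma scale_fibre_inj c : (c != 0)%R -> injective (scale_fibre c).
Proof.
move=> c0 u v uv; have := congr1 snd uv; have := congr1 fst uv.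
move/eqP; rewrite scale_fibre_eq1 // => /eqP.
by case: u v {uv} => [i x] [j y] /= -> ->.
Qed.

Lemma scale_fibre_adj c u v : (c != 0)%R ->
  adj u v -> adj (scale_fibre c u) (scale_fibre c v).
Proof.
move=> c0 /andP[uv1 uv2]; apply/andP; split=> //.
by move: uv1; rewrite /= /complete_adj -(scale_fibre_eq1 u v c0).
Qed.

End FibreLabeling.

Theorem theorem3p2 (p : nat) (G : sgraph) (p_prime : prime p) (p_odd : odd p)
    (G_connected : connected G) (G_bipartite : bipartite G) :
  legendre_cordial p (tensor 'K_p G).
Proof.
have p_gt2 : 2 < p by apply: odd_prime_gt2.
have [V1 [V2 [V1n0 V2n0 V12 V12d bip]]] := G_bipartite.
have sides x y : adj x y -> (x \in V1) != (y \in V1).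
  have V2E z : z \in V2 -> z \notin V1.
    by move=> z2; rewrite (disjointFl V12d).
  by move/bip/orP=> [] /andP[-> /V2E/negbTE->].
split.
  apply: complete_tensor_connected => //.
  have [a aV1] := set0Pn _ V1n0; have [b bV2] := set0Pn _ V2n0.
  have [[|y q] /= aq ab] := connectP (G_connected.2 a b).
    by move: (disjointFr V12d aV1); rewrite -ab bV2.
  by case/andP: aq => ay _; exists a, y.
exists (fibre_label V1); split.
- exact: fibre_label_inj.
- move=> k; split=> [[u <-]|]; [exact: fibre_label_bounds | exact: fibre_label_onto].
(* Scaling the fibres by c flips every edge label. *)
have [|c c0 flip] := @finField_nonsquare_mul 'F_p; first by rewrite card_Fp.
rewrite (@card_edges_labeled_swap _ _ _ (scale_fibre p_prime c)).
- by rewrite subrr normr0.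
- exact: scale_fibre_inj.
- by move=> u v; apply: scale_fibre_adj.
move=> u v /andP[uv1 uv2]; rewrite !legendre_labelE //.
set s := (fibre_label V1 u + fibre_label V1 v)%:R%R.
have -> : ((fibre_label V1 (scale_fibre p_prime c u)
    + fibre_label V1 (scale_fibre p_prime c v))%:R = c * s :> 'F_p)%R.
  rewrite /s !natr_fibre_label_edge ?sides // !natr_scale_fibre.
  by rewrite -mulrBr mulrCA.
have s0 : (s != 0)%R.
  rewrite /s natr_fibre_label_edge ?sides // mulf_neq0 ?signr_eq0 //.
  by rewrite subr_eq0 eqr_nat_Fp // !modn_small ?ltn_ord.
by rewrite mulf_neq0 // s0 flip //; case: is_square.
Qed.
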